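(* Let $(F_n)_{n=0}^\infty=(0,1,1,2,3,5,8,\ldots)$ be the Fibonacci sequence, with $F_0=0$, $F_1=1$, $F_n=F_{n-1}+F_{n-2}$ for $n\ge 2$. Let $m\ge 0$ be an integer and $X=(x_i)_{i=1}^\infty$ a coloration, and let $A(X)=(A_1(X),A_2(X),A_3(X),\ldots)$ be the sequence of the numbers of colored compositions of $1,2,3,\ldots$ with coloration $X$. Then $A(X)=(F_{n+m})_{n=0}^\infty$ if and only if one of the following holds: (i) $m=0$ and $X=(0,1,1,1,1,1,\ldots)$ (that is, $x_1=0$ and $x_i=1$ for all $i\ge 2$); (ii) $m=1$ and $X=(1,0,1,0,1,0,\ldots)$ (that is, $x_i=1$ for $i$ odd and $x_i=0$ for $i$ even); (iii) $m=2$ and $X=(1,1,0,0,0,0,\ldots)$ (that is, $x_1=x_2=1$ and $x_i=0$ for all $i\ge 3$). In particular, for $m\ge 3$ there is no coloration $X$ with $A(X)=(F_{n+m})_{n=0}^\infty$.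
   Context: A coloration is a sequence $X=(x_i)_{i=1}^\infty$ of non-negative integers; $x_i$ is the number of available colors of a part of size $i$ (if $x_i=0$, the part $i$ is not used). A colored composition of $n\ge 1$ with coloration $X$ is a finite ordered sequence of parts, each part being a positive integer $i$ (its size) together with one of its $x_i$ colors, such that the sizes sum to $n$. $A_n(X)$ denotes the number of colored compositions of $n$ with coloration $X$. The equality $A(X)=(F_{n+m})_{n=0}^\infty$ is an equality of sequences term by term, i.e. $A_{n+1}(X)=F_{n+m}$ for all $n\ge 0$. *)

(* Defs.v *)
From HB Require Import structures.
From mathcomp Require Import all_boot.

Set Implicit Arguments.
Unset Strict Implicit.
Unset Printing Implicit Defensive.

(* [X i] is the number of colors available for a part of size [i], for i >= 1;
   the value [X 0] is never used. *)
Definition coloration := nat -> nat.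

(* A colored composition is a list of pairs (size, color), where the colors of
   a part of size [i] are numbered 0, ..., X i - 1. *)
Definition is_colored_composition (X : coloration) (n : nat)
    (s : seq (nat * nat)) : bool :=
  all (fun p => (0 < p.1) && (p.2 < X p.1)) s && (sumn (map fst s) == n).

Record colored_composition (X : coloration) (n : nat) := ColoredComposition {
  parts :> seq (nat * nat);
  partsP : is_colored_composition X n parts
}.

HB.instance Definition _ X n := [isSub for @parts X n].
HB.instance Definition _ X n := [Countable of colored_composition X n by <:].

(* Finiteness of [colored_composition X n]: it has at most [n] parts, each of
   size at most [n], so it occurs in [candidates X n]. *)
Definition words (T : Type) (a : seq T) (k : nat) : seq (seq T) :=
  iter k (fun ws => [seq x :: w | x <- a, w <- ws]) [:: [::]].

Definition candidates (X : coloration) (n : nat) : seq (seq (nat * nat)) :=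
  flatten [seq words [seq (i, c) | i <- iota 1 n, c <- iota 0 (X i)] k
          | k <- iota 0 n.+1].

Lemma mem_words (T : eqType) (a w : seq T) :
  {subset w <= a} -> w \in words a (size w).
Proof.
elim: w => [|x w IHw] sub_wa //=.
apply/allpairsP; exists (x, w); split=> //=; first exact/sub_wa/mem_head.
by apply: IHw => y yw; apply/sub_wa/mem_behead.
Qed.

Lemma mem_candidates X n s :
  is_colored_composition X n s -> s \in candidates X n.
Proof.
case/andP=> /allP s_ok /eqP sum_s; apply/flattenP.
exists (words [seq (i, c) | i <- iota 1 n, c <- iota 0 (X i)] (size s)).
  apply/map_f; rewrite mem_iota /= add0n ltnS -sum_s.
  elim: s s_ok {sum_s} => //= p s IHs s_ok.
  have /andP[p_gt0 _] := s_ok p (mem_head _ _).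
  rewrite -add1n leq_add // IHs // => q qs.
  by apply: s_ok; rewrite inE qs orbT.
apply: mem_words => -[i c] ps; have /andP[/= i_gt0 lt_c] := s_ok _ ps.
apply/allpairsPdep; exists i, c; rewrite !mem_iota /= i_gt0 lt_c.
split=> //; rewrite add1n ltnS -sum_s.
elim: s ps {s_ok sum_s} => //= p s IHs; rewrite inE => /predU1P[<-|/IHs le_i].
  exact: leq_addr.
exact: leq_trans le_i (leq_addl _ _).
Qed.

Definition colored_composition_enum X n : seq (colored_composition X n) :=
  pmap insub (undup (candidates X n)).

Lemma colored_composition_enumP X n :
  Finite.axiom (colored_composition_enum X n).
Proof.
apply: Finite.uniq_enumP => [|s]; first exact/pmap_sub_uniq/undup_uniq.
by rewrite mem_pmap_sub mem_undup mem_candidates //; exact: partsP.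
Qed.

HB.instance Definition _ X n :=
  isFinite.Build (colored_composition X n) (@colored_composition_enumP X n).

Definition num_colored_compositions (X : coloration) (n : nat) : nat :=
  #|{: colored_composition X n}|.

Fixpoint fib (n : nat) : nat :=
  match n with
  | 0 => 0
  | 1 => 1
  | (k.+1 as k').+1 => fib k' + fib k
  end.

(* Main.v *)
Require Import Defs.
From mathcomp Require Import all_boot.
From mathcomp Require Import zify.

Set Implicit Arguments.
Unset Strict Implicit.
Unset Printing Implicit Defensive.

(** Removing the first part of a composition gives the convolution recurrence
    [A_{n+1} = \sum_(i <= n) x_{i+1} A_{n-i}] with [A_0 = 1]
    ([num_colored_compositionsS]).

    Its term at [i = n] is [x_{n+1}] and the others only involve smaller
    indices, so the sequence [A] determines the coloration
    ([num_colored_compositions_inj]).  Hence for each [m] at most one coloration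
    works, and for [m = 0, 1, 2] it is enough to check that the displayed
    coloration gives the right sequence: in each of the three cases the
    recurrence collapses to that of Fibonacci.

    No other [m] is possible: [A_1 = x_1] and [A_2 = x_1 ^ 2 + x_2] force
    [F_m ^ 2 <= F_{m+1}], whereas for [m >= 3] one has [F_m >= 2], hence
    [F_{m+1} = F_m + F_{m-1} < 2 F_m <= F_m ^ 2] ([fib_lt_sqr]). *)

(** * The convolution recurrence *)

Lemma is_colored_composition_cons (X : coloration) (n i c : nat) s :
  is_colored_composition X n.+1 ((i.+1, c) :: s) =
  [&& i <= n, c < X i.+1 & is_colored_composition X (n - i) s].
Proof.
rewrite /is_colored_composition /=.
case: (c < X i.+1) => /=; last by rewrite andbF.
case: (all _ s) => /=; last by rewrite andbF.
by apply/idP/idP; lia.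
Qed.

Lemma num_colored_compositions0 X : num_colored_compositions X 0 = 1.
Proof.
have nil_ok : is_colored_composition X 0 [::] by [].
apply/eqP/fintype1P; exists (ColoredComposition nil_ok) => s; apply/val_inj.
by case: s => -[|[[|i] c] s] //; rewrite /is_colored_composition /= andbF.
Qed.

(** Splitting a composition of [n + 1] into its first part and the rest: the
    index [i] stands for a first part of size [i + 1], which is never zero. *)
Definition head_tail (X : coloration) (n : nat) : finType :=
  {i : 'I_n.+1 & ('I_(X i.+1) * colored_composition X (n - i))%type}.

Lemma cons_colored_compositionP X n (t : head_tail X n) :
  is_colored_composition X n.+1
    (((tag t).+1, val (tagged t).1) :: val (tagged t).2).
Proof.
case: t => i [c s] /=; rewrite is_colored_composition_cons -ltnS !ltn_ord /=.
exact: partsP.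
Qed.

Definition cons_colored_composition X n (t : head_tail X n) :=
  ColoredComposition (cons_colored_compositionP t).

Lemma cons_colored_composition_inj X n :
  injective (@cons_colored_composition X n).
Proof.
move=> [i [c s]] [j [d t]] /(congr1 val) /= [] /val_inj eq_ij.
case: j / eq_ij d t => d t /val_inj-> eq_st.
by have -> : s = t by exact: val_inj.
Qed.

Lemma cons_colored_composition_surj X n (s : colored_composition X n.+1) :
  s \in codom (@cons_colored_composition X n).
Proof.
case: s => -[|[[|i] c] s] s_ok //.
have := s_ok; rewrite is_colored_composition_cons -ltnS => /and3P[lt_i lt_c t_ok].
apply/codomP.
exists (@Tagged _ (Ordinal lt_i)
          (fun i : 'I_n.+1 => ('I_(X i.+1) * colored_composition X (n - i))%type)
          (Ordinal lt_c, ColoredComposition t_ok)).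
exact: val_inj.
Qed.

Lemma num_colored_compositionsS X n :
  num_colored_compositions X n.+1 =
  \sum_(i < n.+1) X i.+1 * num_colored_compositions X (n - i).
Proof.
transitivity #|head_tail X n|.
  rewrite -(card_codom (@cons_colored_composition_inj X n)).
  by apply: eq_card => s; rewrite cons_colored_composition_surj.
rewrite card_tagged sumnE big_map big_enum /=.
by apply: eq_bigr => i _; rewrite card_prod card_ord.
Qed.

Lemma num_colored_compositions1 X : num_colored_compositions X 1 = X 1.
Proof.
by rewrite num_colored_compositionsS big_ord1 num_colored_compositions0 muln1.
Qed.

Lemma num_colored_compositions2 X :
  num_colored_compositions X 2 = X 1 ^ 2 + X 2.
Proof.
rewrite num_colored_compositionsS !big_ord_recr big_ord0 /=.
by rewrite num_colored_compositions1 num_colored_compositions0 muln1.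
Qed.

(** The recurrence is triangular in [X], with coefficient [A_0 = 1] on the
    diagonal. *)
Lemma num_colored_compositions_inj (X Y : coloration) :
  (forall n, num_colored_compositions X n.+1 =
             num_colored_compositions Y n.+1) ->
  forall n, X n.+1 = Y n.+1.
Proof.
move=> eqA; have {}eqA n :
    num_colored_compositions X n = num_colored_compositions Y n.
  by case: n => [|n]; rewrite ?num_colored_compositions0.
elim/ltn_ind => n IHn.
have := eqA n.+1; rewrite !num_colored_compositionsS !big_ord_recr /=.
rewrite subnn !num_colored_compositions0 !muln1 => /eqP.
rewrite (eq_bigr (fun i : 'I_n => Y i.+1 * num_colored_compositions Y (n - i))).
  by rewrite eqn_add2l => /eqP.
by move=> i _; rewrite IHn // eqA.
Qed.

(** * The three colorations *)

Lemma fib_unique (a : nat -> nat) m :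
  a 0 = fib m -> a 1 = fib m.+1 -> (forall n, a n.+2 = a n.+1 + a n) ->
  forall n, a n = fib (n + m).
Proof.
move=> a0 a1 aS n; suff [] : a n = fib (n + m) /\ a n.+1 = fib (n.+1 + m) by [].
by elim: n => [|n [IH0 IH1]]; split=> //; rewrite aS IH0 IH1.
Qed.

Lemma num_colored_compositions_ge2 (X : coloration) :
  X 1 = 0 -> (forall i, 2 <= i -> X i = 1) ->
  forall n, num_colored_compositions X n.+1 = fib (n + 0).
Proof.
move=> X1 X2.
have AE n : num_colored_compositions X n.+1 =
            \sum_(i < n) num_colored_compositions X (n - i.+1).
  rewrite num_colored_compositionsS big_ord_recl X1 mul0n add0n.
  by apply: eq_bigr => i _; rewrite X2 // mul1n.
have AS n : num_colored_compositions X n.+2 =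
            num_colored_compositions X n.+1 + num_colored_compositions X n.
  by rewrite AE big_ord_recl subn1 /= addnC AE.
apply: (@fib_unique (fun n => num_colored_compositions X n.+1)) => [||n].
- by rewrite num_colored_compositions1.
- by rewrite num_colored_compositions2 X1 X2.
- exact: AS.
Qed.

Lemma num_colored_compositions_odd (X : coloration) :
  (forall i, 1 <= i -> X i = if odd i then 1 else 0) ->
  forall n, num_colored_compositions X n.+1 = fib (n + 1).
Proof.
move=> Xodd.
apply: (@fib_unique (fun n => num_colored_compositions X n.+1)) => [||n].
- by rewrite num_colored_compositions1 Xodd.
- by rewrite num_colored_compositions2 !Xodd.
(* Parts of size 1 give A_{n+2}; shrinking a larger first part by 2 gives
   A_{n+1}. *)
rewrite num_colored_compositionsS 2!big_ord_recl !Xodd //= mul1n mul0n add0n.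
rewrite subn0 (num_colored_compositionsS X n); congr (_ + _).
apply: eq_bigr => i _; rewrite /bump /= !add1n !Xodd //= negbK.
by rewrite !subSS.
Qed.

Lemma num_colored_compositions_le2 (X : coloration) :
  X 1 = 1 -> X 2 = 1 -> (forall i, 3 <= i -> X i = 0) ->
  forall n, num_colored_compositions X n.+1 = fib (n + 2).
Proof.
move=> X1 X2 X3.
apply: (@fib_unique (fun n => num_colored_compositions X n.+1)) => [||n].
- by rewrite num_colored_compositions1 X1.
- by rewrite num_colored_compositions2 X1 X2.
rewrite num_colored_compositionsS 2!big_ord_recl big1 => [|i _].
  by rewrite X1 X2 !mul1n addn0 subn0 subn1.
by rewrite X3.
Qed.

(** * The growth obstruction *)

Lemma fib_gt0 n : 0 < fib n.+1.
Proof. by elim: n => // n IHn; rewrite [fib _]/= ltn_addr. Qed.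

Lemma fib_lt_sqr m : 3 <= m -> fib m.+1 < fib m ^ 2.
Proof.
case: m => [|[|[|m]]] // _.
have F1 := fib_gt0 m; have F2 := fib_gt0 m.+1.
have F3 : fib m.+3 = fib m.+2 + fib m.+1 by [].
have F4 : fib m.+4 = fib m.+3 + fib m.+2 by [].
nia.
Qed.

Lemma fib_shift_coloration_lt3 (X : coloration) m :
  (forall n, num_colored_compositions X n.+1 = fib (n + m)) -> m < 3.
Proof.
move=> AX; rewrite ltnNge; apply/negP => /fib_lt_sqr.
have := AX 0; rewrite num_colored_compositions1 => <-.
have := AX 1; rewrite num_colored_compositions2 => <-.
by rewrite ltnNge leq_addr.
Qed.

Theorem mainTheorem3 :
  (forall (m : nat) (X : coloration),
     (forall n : nat, num_colored_compositions X n.+1 = fib (n + m)) <->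
     [\/ m = 0 /\ (X 1 = 0 /\ forall i : nat, 2 <= i -> X i = 1),
         m = 1 /\ (forall i : nat, 1 <= i -> X i = if odd i then 1 else 0)
       | m = 2 /\ (X 1 = 1 /\ X 2 = 1 /\ forall i : nat, 3 <= i -> X i = 0)])
  /\
  (forall m : nat, 3 <= m ->
     ~ exists X : coloration,
         forall n : nat, num_colored_compositions X n.+1 = fib (n + m)).
Proof.
split=> [m X|m m_ge3 [X /fib_shift_coloration_lt3]]; last by rewrite ltnNge m_ge3.
split; last first.
  case=> [[-> [X1 X2]]|[-> Xodd]|[-> [X1 [X2 X3]]]].
  - exact: num_colored_compositions_ge2.
  - exact: num_colored_compositions_odd.
  - exact: num_colored_compositions_le2.
move=> AX; have := fib_shift_coloration_lt3 AX.
have uniqX (Y : coloration) :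
    (forall n, num_colored_compositions Y n.+1 = fib (n + m)) ->
    forall i, 0 < i -> X i = Y i.
  move=> AY [//|i] _; apply: num_colored_compositions_inj => n.
  by rewrite AX AY.
case: m AX uniqX => [|[|[|//]]] AX uniqX _.
- have {}uniqX := uniqX (fun i => if i is _.+2 then 1 else 0)
    (@num_colored_compositions_ge2 (fun i => if i is _.+2 then 1 else 0)
       erefl ltac:(by move=> [|[|i]])).
  by constructor 1; split=> //; split=> [|[|[|i]] // _]; rewrite uniqX.
- have {}uniqX := uniqX (fun i => if odd i then 1 else 0)
    (@num_colored_compositions_odd (fun i => if odd i then 1 else 0)
       ltac:(by [])).
  by constructor 2; split.
- have {}uniqX := uniqX (fun i => if i is _.+3 then 0 else 1)
    (@num_colored_compositions_le2 (fun i => if i is _.+3 then 0 else 1)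
       erefl erefl ltac:(by move=> [|[|[|i]]])).
  by constructor 3; split=> //; split; [|split=> [|[|[|[|i]]] // _]]; rewrite uniqX.
Qed.
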